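(* The bijections $\psi:\mathrm{revSSYT}\to\mathrm{qKT}^{(1)}$ and $\Gamma:\mathrm{revSSYT}\to\mathcal{A}\mathrm{SSF}$ restrict to bijections $\mathrm{HrevSSYT}\to\mathrm{HqKT}^{(1)}$ and $\mathrm{HrevSSYT}\to\mathrm{HSSF}$ respectively.
   Context: $\mathrm{revSSYT}$: reverse semistandard Young tableaux of all partition shapes (English notation; positive integer entries; rows weakly decrease left to right, columns strictly decrease top to bottom). For a weak composition $a$, $D(a)$ has $a_i$ left-justified boxes in row $i$, row 1 lowest. Quasi-key tableau of shape $a$: filling of $D(a)$ with positive integers such that (1) rows weakly decrease and no entry of row $i$ exceeds $i$; (2) column entries distinct, increasing going up the first column; (3) if $i$ is above $k$ in a column with $i<k$, there is an entry $j>i$ immediately right of $k$; (4) for two rows with the higher strictly longer, an entry $i$ in column $c$ of the lower and $j$ in column $c+1$ of the higher satisfy $i<j$. $\mathrm{qKT}^{(1)}$: all quasi-key tableaux (all shapes) with first-column entries equal to row indices. Triples of $D(a)$ (rows $r<s$): Type A: $\gamma=(r,c),\alpha=(r,c+1),\beta=(s,c+1)$, $a_r\ge a_s$; Type B: $\gamma=(s,c),\alpha=(s,c+1),\beta=(r,c)$, $a_s>a_r$; inversion triple: $\beta>\gamma\ge\alpha$ or $\gamma\ge\alpha>\beta$. $\mathcal{A}\mathrm{SSF}$: all fillings of skyline diagrams $D(a)$ (all $a$) with positive integers, rows weakly decreasing, distinct column entries, all triples inversion triples, first-column entry of each nonempty row $i$ equal to $i$. $\psi$ (right row-filling): with column sets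 $C_1,C_2,\ldots$ of $V$, repeatedly let $k$ be the largest index with $C_k\neq\emptyset$, choose the smallest $y_k\in C_k$, then for $c=k-1,\ldots,1$ the smallest $y_c\in C_c$ with $y_c\ge y_{c+1}$; make $(y_1,\ldots,y_k)$ row $y_1$ of the output and delete these elements; it is known to be a bijection onto $\mathrm{qKT}^{(1)}$. $\Gamma$ (column-filling): column 1 of $\Gamma(V)$ places each entry $i$ of column 1 of $V$ in row $i$; given column $c$, the entries of column $c+1$ of $V$ are placed in decreasing order, each in the lowest row that has an entry in column $c$ weakly larger than it and an unfilled position in column $c+1$; it is known to be a bijection $\mathrm{revSSYT}\to\mathcal{A}\mathrm{SSF}$. A filling $X$ (in any of these three sets) is particle-highest if for every entry value $i$ of $X$, the leftmost occurrence of $i$ is in the first column of $X$ or lies in a column weakly left of some occurrence of $j$, where $j$ is the smallest entry of $X$ larger than $i$. $\mathrm{HrevSSYT}$, $\mathrm{HqKT}^{(1)}$, $\mathrm{HSSF}$ denote the particle-highest elements of $\mathrm{revSSYT}$, $\mathrm{qKT}^{(1)}$, $\mathcal{A}\mathrm{SSF}$. *)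

(* Defs.v *)
From mathcomp Require Import all_boot.
Set Implicit Arguments. Unset Strict Implicit. Unset Printing Implicit Defensive.

(* Fillings.  A filling is a [seq (seq nat)]: [nth [::] X r] is the list of  *)
(* entries of the r-th row (0-based index r, i.e. row r+1), read from left   *)
(* to right; column c (0-based) of row r is [nth 0 (nth [::] X r) c].        *)
(*  - for reverse SSYT (English notation) row 1 is the TOP row;              *)
(*  - for skyline fillings of D(a) (quasi-key tableaux, ASSF) row 1 is the   *)
(*    LOWEST row, and row i has a_i boxes.                                   *)

Definition filling := seq (seq nat).

Definition row (X : filling) (r : nat) : seq nat := nth [::] X r.
Definition entry (X : filling) (r c : nat) : nat := nth 0 (row X r) c.
Definition in_cell (X : filling) (r c : nat) : Prop := r < size X /\ c < size (row X r).

Definition all_pos (X : filling) : Prop :=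
  forall r c, in_cell X r c -> 0 < entry X r c.

Definition rows_weakly_decr (X : filling) : Prop :=
  forall r c, in_cell X r c.+1 -> entry X r c.+1 <= entry X r c.

(* Canonical representative of a skyline diagram D(a): no trailing empty
   rows (D(a) and D(a,0) are the same diagram). *)
Definition skyline_wf (X : filling) : Prop := X = [::] \/ last [::] X <> [::].

Definition cols_distinct (X : filling) : Prop :=
  forall r s c, in_cell X r c -> in_cell X s c -> r <> s -> entry X r c <> entry X s c.

Definition revSSYT (T : filling) : Prop :=
  (forall r, r < size T -> row T r <> [::]) /\
  (forall r, r.+1 < size T -> size (row T r.+1) <= size (row T r)) /\
  all_pos T /\
  rows_weakly_decr T /\
  (forall r c, in_cell T r.+1 c -> entry T r.+1 c < entry T r c).

Definition qKT1 (Q : filling) : Prop :=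
  skyline_wf Q /\ all_pos Q /\
  rows_weakly_decr Q /\
  (forall r c, in_cell Q r c -> entry Q r c <= r.+1) /\
  cols_distinct Q /\
  (forall r s, r < s -> in_cell Q r 0 -> in_cell Q s 0 -> entry Q r 0 < entry Q s 0) /\
  (forall r s c, r < s -> in_cell Q r c -> in_cell Q s c ->
     entry Q s c < entry Q r c ->
     in_cell Q r c.+1 /\ entry Q s c < entry Q r c.+1) /\
  (forall r s c, r < s -> size (row Q r) < size (row Q s) ->
     in_cell Q r c -> in_cell Q s c.+1 -> entry Q r c < entry Q s c.+1) /\
  (forall r, in_cell Q r 0 -> entry Q r 0 = r.+1).

Definition inversion_triple (gamma alpha beta : nat) : Prop :=
  (gamma < beta /\ alpha <= gamma) \/ (alpha <= gamma /\ beta < alpha).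

Definition all_triples_inversion (F : filling) : Prop :=
  (forall r s c, r < s -> size (row F s) <= size (row F r) ->
     in_cell F r c -> in_cell F r c.+1 -> in_cell F s c.+1 ->
     inversion_triple (entry F r c) (entry F r c.+1) (entry F s c.+1)) /\
  (forall r s c, r < s -> size (row F r) < size (row F s) ->
     in_cell F s c -> in_cell F s c.+1 -> in_cell F r c ->
     inversion_triple (entry F s c) (entry F s c.+1) (entry F r c)).

Definition ASSF (F : filling) : Prop :=
  skyline_wf F /\ all_pos F /\ rows_weakly_decr F /\ cols_distinct F /\
  all_triples_inversion F /\
  (forall r, in_cell F r 0 -> entry F r 0 = r.+1).

Definition is_entry (X : filling) (v : nat) : Prop :=
  exists r c, in_cell X r c /\ entry X r c = v.

Definition next_entry (X : filling) (i j : nat) : Prop :=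
  i < j /\ is_entry X j /\ (forall k, is_entry X k -> i < k -> j <= k).

Definition particle_highest (X : filling) : Prop :=
  forall i r c, in_cell X r c -> entry X r c = i ->
    (forall r' c', in_cell X r' c' -> entry X r' c' = i -> c <= c') ->
    c = 0 \/
    exists j, next_entry X i j /\
      exists r' c', in_cell X r' c' /\ entry X r' c' = j /\ c <= c'.

Definition HrevSSYT (T : filling) : Prop := revSSYT T /\ particle_highest T.
Definition HqKT1 (Q : filling) : Prop := qKT1 Q /\ particle_highest Q.
Definition HSSF (F : filling) : Prop := ASSF F /\ particle_highest F.

Definition ncols (X : filling) : nat := foldr maxn 0 (map size X).
Definition column (X : filling) (c : nat) : seq nat :=
  [seq nth 0 r c | r <- X & c < size r].
Definition columns (X : filling) : seq (seq nat) := mkseq (column X) (ncols X).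

Definition minge (b : nat) (s : seq nat) : option nat :=
  foldr (fun x acc => if b <= x then
           (match acc with Some y => Some (minn x y) | None => Some x end)
         else acc) None s.

(* given columns C_k, C_{k-1}, ..., C_1, pick y_k, y_{k-1}, ..., y_1 *)
Fixpoint chain (b : nat) (rcs : seq (seq nat)) : seq nat :=
  match rcs with
  | [::] => [::]
  | C :: rest => let y := odflt b (minge b C) in y :: chain y rest
  end.

Fixpoint psi_loop (fuel : nat) (cols : seq (seq nat)) (out : filling) : filling :=
  match fuel with
  | 0 => out
  | n.+1 =>
    if all (fun C => C == [::]) cols then out else
    (* k = largest (1-based) index with C_k nonempty *)
    let k := size cols - find (fun C => C != [::]) (rev cols) in
    let ys := rev (chain 0 (rev (take k cols))) in
    let cols' := [seq rem p.1 p.2 | p <- zip ys cols] ++ drop k cols in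
    psi_loop n cols' (set_nth [::] out (head 0 ys).-1 ys)
  end.

Definition psi (V : filling) : filling :=
  psi_loop (sumn (map size V)) (columns V) [::].

(* place x (into column j+1, 0-based column index j >= 1) in the lowest row
   having an entry >= x in column j (0-based j-1) and no entry yet in
   column j *)
Definition place (j : nat) (out : filling) (x : nat) : filling :=
  let ok := fun r : seq nat => (size r == j) && (x <= nth 0 r j.-1) in
  let r := find ok out in
  if r < size out then set_nth [::] out r (rcons (nth [::] out r) x) else out.

Definition place_column (V : filling) (out : filling) (j : nat) : filling :=
  foldl (place j) out (sort geq (column V j)).

Definition Gamma (V : filling) : filling :=
  let out1 := foldl (fun out i => set_nth [::] out i.-1 [:: i]) [::] (column V 0) in
  foldl (place_column V) out1 (iota 1 (ncols V).-1).

Definition bij_between {A B : Type} (P : A -> Prop) (Q : B -> Prop) (f : A -> B) : Prop :=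
  (forall x, P x -> Q (f x)) /\
  (forall x y, P x -> P y -> f x = f y -> x = y) /\
  (forall y, Q y -> exists x, P x /\ f x = y).

(* Main.v *)
Require Import Defs.
From mathcomp Require Import all_boot.
From mathcomp Require Import zify.
Set Implicit Arguments. Unset Strict Implicit. Unset Printing Implicit Defensive.

(** In each of the three families a filling is determined by its column sets, and psi and Gamma
    preserve column sets; since being particle-highest depends only on the column sets, it suffices
    to show that both maps land in the right family.  Surjectivity then follows because sorting the
    columns of any filling with positive entries, weakly decreasing rows and distinct column entries
    gives a reverse SSYT: consecutive columns C, D satisfy #{y in D | y >= x} <= #{y in C | y >= x}
    for all x, which is also what keeps the two greedy algorithms running.

    For quasi-key tableaux, list the rows by decreasing length and, for equal lengths, by increasing
    last entry.  The quasi-key conditions say exactly that each row R is the one the right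
    row-filling extracts: any entry s in column c of a later row satisfies s < R_(c+1) or s > R_c.
    For semi-skyline fillings, the triple conditions say exactly that every entry of column c+1 sits
    in the lowest row that could receive it when the entries are inserted in decreasing order. *)

(** * Columns of a filling *)

Lemma in_cellE X r c : in_cell X r c <-> c < size (row X r).
Proof.
split=> [[]//|hc]; split=> //; rewrite ltnNge; apply/negP => hr.
by rewrite /row nth_default in hc.
Qed.

Lemma entry_gt0 X r c : 0 < entry X r c -> in_cell X r c.
Proof.
by move=> h; apply/in_cellE; rewrite ltnNge; apply/negP => hc; rewrite /entry nth_default in h.
Qed.

Lemma entry_default X r c : size (row X r) <= c -> entry X r c = 0.
Proof. exact: nth_default. Qed.

Lemma mem_row X r : row X r <> [::] -> row X r \in X.
Proof.
by move=> h; rewrite mem_nth // ltnNge; apply/negP => hr; apply: h; rewrite /row nth_default.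
Qed.

Lemma column_cons R X c :
  column (R :: X) c = if c < size R then nth 0 R c :: column X c else column X c.
Proof. by rewrite /column /=; case: ifP. Qed.

Lemma column_cat X Y c : column (X ++ Y) c = column X c ++ column Y c.
Proof. by rewrite /column filter_cat map_cat. Qed.

Lemma columnP X c x :
  reflect (exists r, in_cell X r c /\ entry X r c = x) (x \in column X c).
Proof.
apply: (iffP mapP) => [[R]|[r [[hr hc] <-]]].
  rewrite mem_filter => /andP[hc hR] ->; exists (index R X).
  by rewrite /in_cell /entry /row nth_index // index_mem.
by exists (row X r); rewrite ?mem_filter ?hc ?mem_nth.
Qed.

Lemma count_column p X c :
  count p (column X c) = count (fun R => (c < size R) && p (nth 0 R c)) X.
Proof. by rewrite /column count_map count_filter; apply: eq_count => R /=; rewrite andbC. Qed.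

Lemma perm_column X Y c : perm_eq X Y -> perm_eq (column X c) (column Y c).
Proof. by move=> h; apply: perm_map; apply: perm_filter. Qed.

Lemma cols_distinctP X : cols_distinct X <-> forall c, uniq (column X c).
Proof.
elim: X => [|R X IH]; first by split=> // _ r s c /in_cellE; rewrite /row nth_nil.
split=> [hd c|hu].
  have hX : cols_distinct X.
    move=> r s d hr hs rs; apply: (hd r.+1 s.+1 d); try exact/in_cellE/in_cellE.
    by case.
  rewrite column_cons; case: ifP => hc; last exact: IH.1.
  rewrite /= (IH.1 hX) andbT; apply/negP => /columnP[r [hr e]].
  by apply: (hd r.+1 0 c); rewrite // in_cellE.
have hX c : uniq (column X c).
  by have := hu c; rewrite column_cons; case: ifP => //= _ /andP[].
have h0 s c : c < size R -> in_cell X s c -> entry X s c <> nth 0 R c.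
  move=> hR hs e; have := hu c; rewrite column_cons hR /= => /andP[/negP hn _]; apply: hn.
  by apply/columnP; exists s.
case=> [|r] [|s] c /in_cellE /= hr /in_cellE /= hs rs //.
- by move/esym; apply: h0 => //; apply/in_cellE.
- by apply: h0 => //; apply/in_cellE.
by apply: (IH.2 hX); rewrite ?in_cellE //; move=> e; apply: rs; rewrite e.
Qed.

(** Since the last row is nonempty, the number of rows is determined: a surplus last row would have
    to equal the default empty row. *)
Lemma filling_ext X Y :
  skyline_wf X -> skyline_wf Y -> (forall r, row X r = row Y r) -> X = Y.
Proof.
suff le_size A B : skyline_wf A -> (forall r, row A r = row B r) -> size A <= size B.
  move=> hX hY e; apply: (@eq_from_nth _ [::]) => [|r _]; last exact: e.
  by apply/eqP; rewrite eqn_leq !le_size // => r; rewrite e.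
case=> [->//|hA] e; case: A hA e => // R A hA e.
rewrite leqNgt; apply/negP => hs; apply: hA.
rewrite -nth_last /= -[LHS]/(row (R :: A) (size A)) e /row nth_default //.
Qed.

Lemma seq_ext (s t : seq nat) :
  (forall i, (i < size s) = (i < size t)) -> (forall i, nth 0 s i = nth 0 t i) -> s = t.
Proof.
move=> hs hn; apply: (@eq_from_nth _ 0) => [|i _]; last exact: hn.
by apply/eqP; rewrite eqn_leq; have := hs (size s); have := hs (size t); rewrite !ltnn; lia.
Qed.

(** Equivalently, after sorting both lists decreasingly, every entry of [D] is matched by a weakly
    larger entry of [C] at the same rank. *)
Definition dom (C D : seq nat) := forall x, count (leq x) D <= count (leq x) C.

Lemma dom_size C D : dom C D -> size D <= size C.
Proof.
have c0 s : count (leq 0) s = size s by elim: s => //= x s ->.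
by move=> /(_ 0); rewrite !c0.
Qed.

(** If an entry of column [c.+1] is at least [x], so is its left neighbour; the counts are compared
    row by row. *)
Lemma dom_column X c :
  rows_weakly_decr X -> dom (column X c) (column X c.+1).
Proof.
move=> hX x; rewrite !count_column.
have: {in X, forall R, c.+1 < size R -> nth 0 R c.+1 <= nth 0 R c}.
  move=> R hR hc; have e : row X (index R X) = R by rewrite /row nth_index.
  by rewrite -e; apply: hX; apply/in_cellE; rewrite e.
elim: X {hX} => //= R X IH hX; apply: leq_add; last first.
  by apply: IH => S hS; apply: hX; rewrite inE hS orbT.
have := hX R (mem_head _ _); case: ltnP => //= hc /(_ isT) h.
by rewrite (ltnW hc) /=; case: (leqP x (nth 0 R c.+1)) => // hx; rewrite (leq_trans hx h).
Qed.

(** In a decreasing list the entries at least [x] form a prefix; positivity of [x] excludes the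
    default 0 past the end. *)
Lemma count_ge_sorted s x r :
  sorted geq s -> 0 < x -> (r < count (leq x) s) = (x <= nth 0 s r).
Proof.
move=> hs hx; elim: s r hs => [|y s IH] r /= hs; first by rewrite nth_nil; lia.
have hp := order_path_min (rev_trans leq_trans) hs.
case: (leqP x y) => hy.
  by case: r => //= r; rewrite -IH ?add1n // (path_sorted hs).
have -> : count (leq x) s = 0.
  apply/eqP; rewrite -leqn0 leqNgt -has_count -all_predC.
  by apply: sub_all hp => z /= hz; rewrite -ltnNge (leq_ltn_trans hz).
case: r => /= [|r]; first lia.
have := hp => /all_nthP => /(_ 0 r).
case: (ltnP r (size s)) => hr; last by rewrite nth_default //; lia.
by move=> /(_ isT) /=; lia.
Qed.

Lemma uniq_sorted_gtn s : uniq s -> sorted gtn (sort geq s).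
Proof.
move=> h; rewrite gtn_sorted_uniq_geq sort_uniq h; apply: sort_sorted => x y.
exact: leq_total.
Qed.

(** * Reverse tableaux and their columns *)

Definition partition_shaped (X : filling) :=
  forall r, size (row X r.+1) <= size (row X r).

(** In a partition shape each column fills an initial segment of the rows, so the filtering in
    [column] shifts no index. *)
Lemma column_partition X c r : partition_shaped X ->
  (r < size (column X c)) = (c < size (row X r)) /\ nth 0 (column X c) r = entry X r c.
Proof.
elim: X r => [|R X IH] r hX.
  by rewrite /entry /row /column !nth_nil.
have {}IH s := IH s (fun t => hX t.+1).
rewrite column_cons; case: (ltnP c (size R)) => hc.
  by case: r => [|r]; [rewrite /row /= hc | have := IH r].
have le_R s : size (row (R :: X) s) <= size R.
  by elim: s => // s; apply: leq_trans; exact: hX.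
have -> : column X c = [::].
  apply/eqP; rewrite -size_eq0 -leqn0 leqNgt (IH 0).1 -leqNgt.
  by apply: leq_trans hc; exact: (le_R 1).
rewrite nth_nil ltn0 entry_default; last exact: leq_trans (le_R r) hc.
by rewrite ltnNge (leq_trans (le_R r) hc).
Qed.

Lemma revSSYT_partition T : revSSYT T -> partition_shaped T.
Proof.
case=> _ [hs _] r; case: (ltnP r.+1 (size T)) => hr; first exact: hs.
by rewrite {1}/row nth_default.
Qed.

Lemma revSSYT_column_sorted T c : revSSYT T -> sorted gtn (column T c).
Proof.
move=> hT; apply/(sortedP 0) => r hr; have hp := revSSYT_partition hT.
rewrite !(column_partition _ _ hp).2; apply: hT.2.2.2.2; apply/in_cellE.
by rewrite -(column_partition _ _ hp).1.
Qed.

Lemma revSSYT_distinct T : revSSYT T -> cols_distinct T.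
Proof.
move=> hT; apply/cols_distinctP => c.
by have := revSSYT_column_sorted c hT; rewrite gtn_sorted_uniq_geq => /andP[].
Qed.

Lemma revSSYT_inj T U : revSSYT T -> revSSYT U ->
  (forall c, column T c =i column U c) -> T = U.
Proof.
have wf V : revSSYT V -> skyline_wf V.
  move=> hV; case: V hV => [|R V] hV; [by left|right].
  by rewrite -nth_last /=; apply: hV.1.
move=> hT hU e; apply: filling_ext; [exact: wf | exact: wf | move=> r].
have {}e c : column T c = column U c.
  apply: (irr_sorted_eq (leT := gtn)) (e c); try exact: revSSYT_column_sorted; last exact: ltnn.
  by move=> y x z /= h1 h2; apply: ltn_trans h2 h1.
have hpT := revSSYT_partition hT; have hpU := revSSYT_partition hU.
apply: seq_ext => c.
  by rewrite -(column_partition _ _ hpT).1 -(column_partition _ _ hpU).1 e.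
by rewrite -[LHS](column_partition _ _ hpT).2 -[RHS](column_partition _ _ hpU).2 e.
Qed.

(** * Straightening a filling into a reverse tableau *)

Lemma size_row_ncols X r : size (row X r) <= ncols X.
Proof.
rewrite /ncols; elim: X r => [|R X IH] [|r] //=; first exact: leq_maxl.
by apply: leq_trans (IH r) _; exact: leq_maxr.
Qed.

Lemma column_size_le X m c : (forall r, size (row X r) <= m) -> m <= c -> column X c = [::].
Proof.
move=> h mc; case e: (column X c) => [//|x s].
have: x \in column X c by rewrite e mem_head.
by case/columnP => r [/in_cellE]; have := h r; lia.
Qed.

Lemma column_ncols X c : ncols X <= c -> column X c = [::].
Proof. exact: column_size_le (size_row_ncols X). Qed.

Lemma nth_columns X c : nth [::] (columns X) c = column X c.
Proof.
rewrite /columns; case: (ltnP c (ncols X)) => hc; first by rewrite nth_mkseq.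
by rewrite nth_default ?size_mkseq // column_ncols.
Qed.

(** The sorted columns are stored as the rows of [S]; reading off the columns of [S] transposes them
    back. *)
Definition straighten (Q : filling) : filling :=
  let S := [seq sort geq C | C <- columns Q] in mkseq (column S) (size (column Q 0)).

Lemma straightenP Q : all_pos Q -> rows_weakly_decr Q -> cols_distinct Q ->
  revSSYT (straighten Q) /\ forall c, column (straighten Q) c =i column Q c.
Proof.
move=> hpos hdec /cols_distinctP hd; rewrite /straighten.
set S := map _ _.
have rowS c : row S c = sort geq (column Q c).
  rewrite -nth_columns /row /S; case: (ltnP c (size (columns Q))) => hc.
    by rewrite (nth_map [::]).
  by rewrite (nth_default _ hc) nth_default // size_map.
have srtS c : sorted geq (row S c).
  by rewrite rowS; apply: sort_sorted => x y; exact: leq_total.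
have posS c r : r < size (row S c) -> 0 < entry S c r.
  rewrite /entry rowS => hr; have := mem_nth 0 hr; rewrite mem_sort => /columnP[s [hs <-]].
  exact: hpos.
have decS c r : entry S c.+1 r <= entry S c r.
  case: (posnP (entry S c.+1 r)) => [->//|h0].
  (* As [x] has rank [r] in its sorted column, more than [r] entries there are at least [x];
     dominance carries this to column [c]. *)
  set x := entry S c.+1 r in h0 *.
  rewrite /entry -count_ge_sorted //.
  apply: (@leq_trans (count (leq x) (row S c.+1))); first by rewrite count_ge_sorted.
  rewrite !rowS.
  have cs p s : count p (sort geq s) = count p s.
    by apply/permP; rewrite perm_sort.
  by rewrite !cs; exact: dom_column.
have hS : partition_shaped S.
  by move=> c; rewrite !rowS !size_sort; apply: dom_size; apply: dom_column.
set T := mkseq _ _.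
have rowT r : row T r = column S r.
  rewrite /row /T; case: (ltnP r (size (column Q 0))) => hr; first by rewrite nth_mkseq.
  rewrite nth_default ?size_mkseq //; apply/esym/eqP; rewrite -size_eq0 -leqn0 leqNgt.
  by rewrite (column_partition _ _ hS).1 rowS size_sort -leqNgt.
have sizeT r c : (c < size (row T r)) = (r < size (row S c)).
  by rewrite rowT (column_partition _ _ hS).1.
have entryT r c : entry T r c = entry S c r.
  by rewrite /entry rowT (column_partition _ _ hS).2.
have hT : partition_shaped T.
  move=> r; rewrite leqNgt; apply/negP; rewrite sizeT => h.
  by have := sizeT r (size (row T r)); rewrite ltnn (ltnW h).
split; last first.
  move=> c x; rewrite -[RHS](mem_sort geq) -rowS; congr (x \in _).
  apply: seq_ext => r; first by rewrite (column_partition _ _ hT).1 sizeT.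
  by rewrite (column_partition _ _ hT).2 entryT.
split=> [r|].
  rewrite size_mkseq => hr h; have := sizeT r 0.
  by rewrite h rowS size_sort hr.
split=> [r _|]; first exact: hT.
split=> [r c /in_cellE|]; first by rewrite sizeT entryT; exact: posS.
split=> [r c _|r c /in_cellE]; first by rewrite !entryT.
rewrite sizeT !entryT /entry rowS => hr.
by have /(sortedP 0) := uniq_sorted_gtn (hd c); apply.
Qed.

(** * Reduction of both bijections to column sets *)

Lemma particle_highest_columns X Y :
  (forall c, column X c =i column Y c) -> particle_highest X -> particle_highest Y.
Proof.
move=> e hX i r c hr hi hmin.
have toX r' c' : in_cell Y r' c' ->
    exists s, in_cell X s c' /\ entry X s c' = entry Y r' c'.
  by move=> h; apply/columnP; rewrite e; apply/columnP; exists r'.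
have toY r' c' : in_cell X r' c' ->
    exists s, in_cell Y s c' /\ entry Y s c' = entry X r' c'.
  by move=> h; apply/columnP; rewrite -e; apply/columnP; exists r'.
have [s [hs es]] := toX _ _ hr.
case: (hX i s c hs) => [||->|[j [[ij [[r1 [c1 [h1 e1]]] jmin]] [r' [c' [hr' [ej cc]]]]]]].
- by rewrite es.
- move=> r' c' /toY [t [ht et]] ei; apply: (hmin t) => //; by rewrite et.
- by left.
right; exists j; split; last first.
  have [t [ht et]] := toY _ _ hr'.
  by exists t, c'; rewrite et.
split=> //; split.
  have [t [ht et]] := toY _ _ h1.
  by exists t, c1; rewrite et.
move=> k [r2 [c2 [h2 e2]]] ik; apply: jmin => //.
have [t [ht et]] := toX _ _ h2.
by exists t, c2; rewrite et.
Qed.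

(** The preimage of [Q] is [straighten Q]: its image and [Q] both satisfy [P] and share their column
    sets, hence coincide. *)
Lemma bij_of_columns (P : filling -> Prop) (f : filling -> filling) :
  (forall T, revSSYT T -> P (f T) /\ forall c, column (f T) c =i column T c) ->
  (forall Q, P Q -> [/\ all_pos Q, rows_weakly_decr Q & cols_distinct Q]) ->
  (forall Q U, P Q -> P U -> (forall c, column Q c =i column U c) -> Q = U) ->
  bij_between HrevSSYT (fun Q => P Q /\ particle_highest Q) f.
Proof.
move=> hf hP hinj; split=> [T [hT phT]|].
  have [? e] := hf T hT; split=> //.
  by apply: particle_highest_columns phT => c x; rewrite e.
split=> [T U [hT _] [hU _] efTU|Q [hQ phQ]].
  apply: revSSYT_inj => // c x.
  by rewrite -(hf T hT).2 -(hf U hU).2 efTU.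
have [hpos hdec hd] := hP Q hQ.
have [hT eT] := straightenP hpos hdec hd.
exists (straighten Q); split; first split=> //.
  by apply: particle_highest_columns phQ => c x; rewrite eT.
have [hfT efT] := hf _ hT.
by apply: hinj => // c x; rewrite efT eT.
Qed.

(** * Quasi-key tableaux as lists of rows *)

Definition setrow (X : filling) (R : seq nat) := set_nth [::] X (head 0 R).-1 R.

(** Separates the order in which rows are listed from their positions: [L] lists the nonempty rows
    in any order, and first entries give the positions. *)
Definition assembles (X L : filling) :=
  [/\ skyline_wf X,
      forall r, row X r <> [::] -> row X r \in L /\ entry X r 0 = r.+1 &
      forall R, R \in L -> row X (head 0 R).-1 = R].

Lemma row_setrow X R r :
  row (setrow X R) r = if r == (head 0 R).-1 then R else row X r.
Proof. by rewrite /row /setrow nth_set_nth /=. Qed.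

Lemma skyline_wf_setrow X R : skyline_wf X -> R <> [::] -> skyline_wf (setrow X R).
Proof.
move=> hX hR; right; rewrite -nth_last -[X in X <> _]/(row _ _) row_setrow.
rewrite /setrow size_set_nth; case: eqP => // /eqP hne.
case: hX => [e|hX]; first by move: hne; rewrite e maxn0 eqxx.
have -> : (maxn (head 0 R).-1.+1 (size X)).-1 = (size X).-1 by lia.
by rewrite /row nth_last.
Qed.

Lemma assembles_setrow X L R :
  assembles X L -> 0 < head 0 R -> all (fun S => 0 < head 0 S) L ->
  head 0 R \notin map (head 0) L -> assembles (setrow X R) (R :: L).
Proof.
move=> [wfX hX hL] hR /allP hpos hnew; split.
- by apply: skyline_wf_setrow => // e; rewrite e in hR.
- move=> r; rewrite /entry row_setrow; case: eqP => [-> _|_ /hX[h e]].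
    by rewrite mem_head nth0 prednK.
  by rewrite inE h orbT -e.
move=> S; rewrite row_setrow inE => /orP[/eqP ->|hS]; first by rewrite eqxx.
case: eqP => [e|_]; last exact: hL.
case/negP: hnew; apply/mapP; exists S => //.
by rewrite -(prednK hR) -e prednK // hpos.
Qed.

(** Each placed row is prepended to the list of rows already present, so the accumulated list is
    [catrev L M]. *)
Lemma assembles_foldl X M L :
  assembles X M -> all (fun S => 0 < head 0 S) (catrev L M) ->
  uniq (map (head 0) (catrev L M)) -> assembles (foldl setrow X L) (catrev L M).
Proof.
elim: L X M => //= R L IH X M hX hpos hu; apply: IH => //.
move: hpos hu; rewrite !catrevE all_cat map_cat cat_uniq /=.
move=> /andP[_ /andP[hR hM]] /and3P[_ _ /andP[hn _]].
exact: assembles_setrow.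
Qed.

Lemma assembles_foldl0 L :
  all (fun S => 0 < head 0 S) L -> uniq (map (head 0) L) ->
  assembles (foldl setrow [::] L) L.
Proof.
move=> hpos hu.
have [|||wf h1 h2] := @assembles_foldl [::] [::] L.
- by split=> [|r|R]; rewrite ?in_nil //; [left | rewrite /row nth_nil].
- by rewrite catrevE cats0 all_rev.
- by rewrite catrevE cats0 map_rev rev_uniq.
split=> // [r /h1|R hR]; first by rewrite catrevE cats0 mem_rev.
by apply: h2; rewrite catrevE cats0 mem_rev.
Qed.

Lemma assembles_column X L c : all (fun S => 0 < head 0 S) L ->
  assembles X L -> column X c =i column L c.
Proof.
move=> hpos [_ hX hL] x; apply/columnP/mapP.
  move=> [r [/in_cellE hc <-]]; exists (row X r) => //.
  rewrite mem_filter hc; apply: (hX r _).1; by move=> e; rewrite e in hc.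
move=> [R]; rewrite mem_filter => /andP[hc hR] ->.
exists (head 0 R).-1; rewrite in_cellE /entry hL //.
Qed.

Lemma assembles_inj X Y L : assembles X L -> assembles Y L -> X = Y.
Proof.
move=> [wfX hX hXL] [wfY hY hYL]; apply: filling_ext => // r.
case: (row X r =P [::]) => [eX|/hX [h e]].
  case: (row Y r =P [::]) => [-> //|/hY [h e]].
  by have := hXL _ h; rewrite -nth0 -/(entry Y r 0) e eX => <-.
by have := hYL _ h; rewrite -nth0 -/(entry X r 0) e.
Qed.

Definition good_row (R : seq nat) := [&& R != [::], 0 \notin R & sorted geq R].

Lemma good_row_head R : good_row R -> 0 < head 0 R.
Proof.
case: R => //= x R /and3P[_ h _]; move: h; rewrite inE lt0n eq_sym negb_or.
by case/andP.
Qed.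

Lemma good_row_nth R c : good_row R -> c < size R -> 0 < nth 0 R c.
Proof.
case/and3P=> _ h _ hc; rewrite lt0n; apply: contra h => /eqP <-; exact: mem_nth.
Qed.

(** Also valid at and past the end of the row, thanks to the default value 0. *)
Lemma good_row_decr R c : good_row R -> nth 0 R c.+1 <= nth 0 R c.
Proof.
case/and3P=> _ _ /(sortedP 0) h; case: (ltnP c.+1 (size R)) => hc; first exact: h.
by rewrite nth_default.
Qed.

Lemma good_rowP R : R <> [::] ->
  (forall c, c < size R -> 0 < nth 0 R c) ->
  (forall c, c.+1 < size R -> nth 0 R c.+1 <= nth 0 R c) -> good_row R.
Proof.
move=> h0 hp hd; apply/and3P; split; first exact/eqP.
  by apply/negP => /(nthP 0) [c hc e]; have := hp c hc; rewrite e.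
by apply/(sortedP 0).
Qed.

Lemma nth_mem_column L R : R \in L -> forall c, c < size R -> nth 0 R c \in column L c.
Proof. by move=> hR c hc; apply/mapP; exists R; rewrite ?mem_filter ?hc. Qed.

(* [S] may be extracted after [R] by the right row-filling; the default value
   [nth 0 R (size R) = 0] makes the last entry of [R] the minimum of its column. *)
Definition after (R S : seq nat) :=
  (size S <= size R) &&
  all (fun c => (nth 0 S c < nth 0 R c.+1) || (nth 0 R c < nth 0 S c)) (iota 0 (size S)).

Lemma afterP R S :
  reflect (size S <= size R /\ forall c, c < size S ->
             nth 0 S c < nth 0 R c.+1 \/ nth 0 R c < nth 0 S c) (after R S).
Proof.
apply: (iffP andP) => -[h1 h2]; split=> //.
  by move=> c hc; move/allP/(_ c): h2; rewrite mem_iota => /(_ hc) /orP.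
by apply/allP => c; rewrite mem_iota => hc; apply/orP; exact: h2.
Qed.

(** The columns determine the first row: it reaches the last nonempty column, and from right to left
    its entry in column [c] is the smallest one at least its entry in column [c.+1]. Removing it
    leaves a shorter list of the same kind. *)
Lemma pairwise_after_inj L M :
  all good_row L -> all good_row M -> pairwise after L -> pairwise after M ->
  (forall c, perm_eq (column L c) (column M c)) -> L = M.
Proof.
elim: L M => [|R L IH] [|S M] //.
- move=> _ /= /andP[gS _] _ _ /(_ 0); rewrite column_cons.
  by case: S gS => //= x S _ /perm_size.
- move=> /= /andP[gR _] _ _ _ /(_ 0); rewrite column_cons.
  by case: R gR => //= x R _ /perm_size.
move=> /= /andP[gR gL] /andP[gS gM] /andP[/allP aR aL] /andP[/allP aS aM] e.
have lesz N A B : {in N, forall D, after A D} -> B \in A :: N -> size B <= size A.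
  by move=> h; rewrite inE => /orP[/eqP -> //|/h/afterP[]].
have lt_size A B N N' c : (forall c, column (A :: N) c =i column (B :: N') c) ->
    {in N', forall D, after B D} -> c < size A -> c < size B.
  move=> ee h hc; have := nth_mem_column (mem_head A N) hc; rewrite ee.
  case/mapP => D; rewrite mem_filter => /andP[hcD /(lesz _ _ _ h) hs] _.
  exact: leq_trans hs.
have ee c : column (R :: L) c =i column (S :: M) c by exact: perm_mem.
(* The entry of [B] in column [c] lies in [A] or in a row after [A]. In the latter case it is at
   least the common entry in column [c.+1], so it must exceed the entry of [A]. *)
have le_nth A B N N' c : good_row B -> (forall c, column (A :: N) c =i column (B :: N') c) ->
   {in N, forall D, after A D} -> c < size B ->
   nth 0 A c.+1 = nth 0 B c.+1 -> nth 0 A c <= nth 0 B c.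
  move=> gB {}ee h hc en; have := nth_mem_column (mem_head B N') hc; rewrite -ee.
  case/mapP => D; rewrite mem_filter => /andP[hcD]; rewrite inE => /orP[/eqP -> -> //|].
  move=> /h/afterP [_ /(_ c hcD)] hh eD; rewrite eD.
  by have := good_row_decr c gB; rewrite eD -en; lia.
have eRS : R = S.
  have esz c : (c < size R) = (c < size S).
    by apply/idP/idP; [apply: lt_size ee aS | apply: lt_size (fun c => fsym (ee c)) aR].
  apply: seq_ext => // c.
  (* Induction from right to left, starting past the end, where both rows read 0. *)
  have [n hn] := ubnP (size R - c); elim: n c hn => // n IHn c hn.
  case: (ltnP c (size R)) => hc; last first.
    by rewrite !nth_default // leqNgt -esz -leqNgt.
  have en : nth 0 R c.+1 = nth 0 S c.+1 by apply: IHn; lia.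
  apply/eqP; rewrite eqn_leq (le_nth _ _ L M) //= -?esz // (le_nth _ _ M L) // => c'.
  exact: fsym (ee c').
rewrite -eRS in e *; congr cons; apply: IH => // c.
by have := e c; rewrite !column_cons; case: ifP; rewrite ?perm_cons.
Qed.

Lemma pairwise_mem (T : eqType) (p : rel T) L x y :
  pairwise p L -> x \in L -> y \in L -> x <> y -> p x y \/ p y x.
Proof.
elim: L => //= z L IH /andP[/allP hz hL]; rewrite !inE.
move=> /orP[/eqP -> | hx] /orP[/eqP -> | hy] xy //.
- by left; apply: hz.
- by right; apply: hz.
exact: IH.
Qed.

(** For rows [r < s] there are two cases. If [r] is listed first, [after] is directly the third
    quasi-key condition; if [s] is listed first, [shift] makes that condition vacuous and yields the
    fourth. *)
Lemma qKT1_assembles Q L :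
  all good_row L -> pairwise after L -> assembles Q L -> qKT1 Q.
Proof.
move=> /allP gL pL [wf hQ hL].
have inL r c : in_cell Q r c -> row Q r \in L /\ entry Q r 0 = r.+1.
  by move=> /in_cellE h; apply: hQ => e; rewrite e in h.
have le0 r c : in_cell Q r c -> entry Q r c <= r.+1.
  move=> h; have [/gL gr <-] := inL _ _ h.
  elim: c {h} => // c; apply: leq_trans; exact: good_row_decr.
have pair r s c : r < s -> in_cell Q r c -> in_cell Q s c ->
    after (row Q r) (row Q s) \/ after (row Q s) (row Q r).
  move=> rs /inL[hr er] /inL[hs es]; apply: (pairwise_mem pL) => // e.
  by move: er es; rewrite /entry e => ->; lia.
(* In column 0 the higher row has the larger entry, which forces the first alternative of [after];
   weak decrease along both rows propagates it to the right. *)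
have shift r s c : r < s -> in_cell Q r c -> in_cell Q s c ->
    after (row Q s) (row Q r) -> entry Q r c < entry Q s c.+1.
  move=> rs hr hs /afterP[sz hh]; have [Lr er] := inL _ _ hr; have [Ls es] := inL _ _ hs.
  move/in_cellE in hr; elim: c hr {hs} => [|c IH] hc.
    by have := hh 0 hc; rewrite -/(entry Q r 0) -/(entry Q s 0) er es /entry; lia.
  have := IH (ltnW hc); have := hh _ hc; have := good_row_decr c (gL _ Lr).
  rewrite /entry; lia.
have inv r s c : r < s -> in_cell Q r c -> in_cell Q s c ->
    entry Q s c < entry Q r c -> entry Q s c < entry Q r c.+1.
  move=> rs hr hs lt; case: (pair r s c) => // [/afterP[_ h]|/shift h].
    by have := h c ((in_cellE _ _ _).1 hs); move: lt; rewrite /entry; lia.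
  have := h c rs hr hs; have [/gL gs _] := inL _ _ hs.
  by have := good_row_decr c gs; move: lt; rewrite /entry; lia.
split=> //; split=> [r c h|].
  by have [/gL gr _] := inL _ _ h; apply: good_row_nth => //; apply/in_cellE.
split=> [r c h|].
  by have [/gL gr _] := inL _ _ h; exact: good_row_decr.
split=> //; split.
  have half r s c : r < s -> in_cell Q r c -> in_cell Q s c -> entry Q r c <> entry Q s c.
    move=> rs hr hs e; have [/gL gr _] := inL _ _ hr; have [/gL gs _] := inL _ _ hs.
    have := good_row_decr c gr; have := good_row_decr c gs; move: e; rewrite /entry.
    case: (pair r s c) => // [/afterP[_ h]|/(shift r s c rs hr hs)].
      have := h c ((in_cellE _ _ _).1 hs); lia.
    by rewrite /entry; lia.
  move=> r s c hr hs rs; case: (ltngtP r s) => // h; first exact: half.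
  by move/esym; apply: half.
split=> [r s rs /inL[_ ->] /inL[_ ->] //|].
split=> [r s c rs hr hs lt|].
  (* An entry with something strictly below it is nonzero, so its cell exists. *)
  by have h := inv _ _ _ rs hr hs lt; split=> //; apply: entry_gt0; apply: leq_trans h.
split=> [r s c rs sz hr hs|r /inL[]//].
have hs' : in_cell Q s c by move/in_cellE: hs => h; apply/in_cellE; exact: ltnW.
case: (pair r s c) => // [/afterP[]|h]; first lia.
exact: shift.
Qed.

(** For two rows in list order, the third condition gives [after] when the earlier row is the lower
    one, and the fourth gives it when the earlier row is higher and strictly longer. *)
Lemma qKT1_list Q : qKT1 Q ->
  exists L, [/\ all good_row L, pairwise after L, assembles Q L &
                forall c, perm_eq (column L c) (column Q c)].
Proof.
move=> [wf [hpos [hdec [_ [hd [_ [h3 [h4 h1]]]]]]]].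
pose before (R S : seq nat) := (size S < size R) || (size S == size R) && (last 0 R <= last 0 S).
have tb : transitive before by move=> y x z; rewrite /before; lia.
have totb : total before by move=> x y; rewrite /before; lia.
pose N := [seq R <- Q | R != [::]]; pose L := sort before N.
have rowN R : R \in N -> exists r, row Q r = R /\ in_cell Q r 0.
  rewrite mem_filter => /andP[h0 hR]; exists (index R Q).
  have e : row Q (index R Q) = R by rewrite /row nth_index.
  by rewrite in_cellE e; case: (R) h0.
have colN c : column N c = column Q c.
  rewrite /column /N -filter_predI; congr map; apply: eq_filter => R /=.
  by case: R => //= x R; rewrite ?andbT.
have goodN R : R \in N -> good_row R.
  move=> hR; have [r [e _]] := rowN R hR; rewrite -e; apply: good_rowP.
  - by move=> e'; move: hR; rewrite -e e' mem_filter.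
  - by move=> c hc; apply: hpos; apply/in_cellE.
  by move=> c hc; apply: hdec; apply/in_cellE.
have uniqN : uniq N.
  have := (cols_distinctP Q).1 hd 0; rewrite -colN /column => /map_uniq.
  by rewrite (_ : [seq R <- N | _] = N) //; apply/all_filterP/allP => -[|x R] // /goodN.
have headN R r : row Q r = R -> in_cell Q r 0 -> head 0 R = r.+1.
  by move=> e hr; rewrite -(h1 _ hr) /entry e nth0.
exists L; split.
- by rewrite all_sort; apply/allP.
- have: pairwise (fun R S => before R S && (R != S)) L.
    rewrite (pairwise_relI before (fun R S => R != S)) -(sorted_pairwise tb).
    by rewrite sort_sorted // -uniq_pairwise sort_uniq.
  apply: (sub_in_pairwise (P := mem N)); last by rewrite all_sort; apply/allP.
  move=> R S hR hS /andP[hb /eqP RS].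
  have [r [eR hr]] := rowN R hR; have [s [eS hs]] := rowN S hS.
  have rs : r <> s by move=> e; apply: RS; rewrite -eR -eS e.
  apply/afterP; rewrite -eR -eS; split.
    by move: hb; rewrite -eR -eS /before; lia.
  move=> c hcs.
  have hcr : c < size (row Q r) by move: hb; rewrite -eR -eS /before in hcs *; lia.
  have cs : in_cell Q s c by exact/in_cellE.
  have cr : in_cell Q r c by exact/in_cellE.
  rewrite -/(entry Q s c) -/(entry Q r c) -/(entry Q r c.+1).
  have := hd _ _ _ cr cs rs.
  case: (ltngtP r s) rs => // rs _ ne.
    by have := h3 _ _ _ rs cr cs; lia.
  move: hb; rewrite /before -eR -eS => /orP[hb|/andP[/eqP eqs hl]].
    by left; apply: h4 => //; apply/in_cellE; apply: leq_ltn_trans hb.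
  (* Equal lengths with the higher row first cannot occur: its last entry would be smaller, and the
     third condition would require a box beyond the end of the lower row. *)
  right; exfalso; pose k := (size (row Q r)).-1.
  have kr : in_cell Q r k by apply/in_cellE; rewrite /k; lia.
  have ks : in_cell Q s k by apply/in_cellE; rewrite /k; lia.
  move: hl; rewrite -!nth_last eqs -/k => hl.
  have [|/in_cellE] := h3 s r k rs ks kr; last by rewrite /k; lia.
  by have := hd r s k kr ks; move: hl; rewrite /entry /k; lia.
- split=> // [r h|R].
    have ir : in_cell Q r 0 by apply/in_cellE; case: (row Q r) h.
    by rewrite mem_sort mem_filter (mem_row h) andbT h1 //; split=> //; apply/eqP.
  rewrite mem_sort => /rowN [r [e hr]]; rewrite (headN _ _ e hr) //.
by move=> c; rewrite -colN; apply: perm_column; rewrite perm_sort.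
Qed.

Lemma qKT1_inj Q U : qKT1 Q -> qKT1 U -> (forall c, column Q c =i column U c) -> Q = U.
Proof.
move=> hQ hU e.
have [L [gL pL aL cL]] := qKT1_list hQ; have [M [gM pM aM cM]] := qKT1_list hU.
apply: assembles_inj aL _; rewrite (pairwise_after_inj gL gM pL pM) // => c.
apply: perm_trans (cL c) _; rewrite perm_sym; apply: perm_trans (cM c) _.
rewrite perm_sym; apply: uniq_perm (e c); apply: (cols_distinctP _).1.
  by case: hQ => _ [_ [_ [_ []]]].
by case: hU => _ [_ [_ [_ []]]].
Qed.

(** * The right row-filling *)

Lemma mingeP b s : has (leq b) s ->
  [/\ odflt b (minge b s) \in s, b <= odflt b (minge b s) &
      forall z, z \in s -> b <= z -> odflt b (minge b s) <= z].
Proof.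
suff: if minge b s is Some y then [/\ y \in s, b <= y & forall z, z \in s -> b <= z -> y <= z]
      else ~~ has (leq b) s.
  by case: (minge b s) => //= /negP.
elim: s => //= x s; rewrite -/(minge b s); case: (minge b s) => [y [ys by_ hy]|hn].
  case: ifP => [bx|/negbT bx].
    rewrite inE; split; first by rewrite /minn; case: ifP; rewrite ?eqxx ?ys ?orbT.
      by rewrite leq_min bx.
    by move=> z; rewrite inE geq_min => /orP[/eqP ->|hz /(hy z hz) ->]; rewrite ?leqnn ?orbT.
  split=> //; first by rewrite inE ys orbT.
  by move=> z; rewrite inE => /orP[/eqP -> h|]; [rewrite h in bx | exact: hy].
case: ifP => [bx|bx] //=.
split=> //; first exact: mem_head.
move=> z; rewrite inE => /orP[/eqP -> //|hz bz].
by case/hasP: hn; exists z.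
Qed.

(** The picks run from the last column to the first, starting from the bound 0; the two reversals
    restore left-to-right order. *)
Definition filled_row (cols : seq (seq nat)) := rev (chain 0 (rev cols)).

Lemma filled_row_cons C cols :
  filled_row (C :: cols) =
  odflt (head 0 (filled_row cols)) (minge (head 0 (filled_row cols)) C) :: filled_row cols.
Proof.
have chain_rcons b l D : chain b (rcons l D) =
    rcons (chain b l) (odflt (last b (chain b l)) (minge (last b (chain b l)) D)).
  by elim: l b => //= E l IH b; rewrite IH.
rewrite /filled_row rev_cons chain_rcons rev_rcons.
rewrite (_ : last 0 _ = head 0 (rev (chain 0 (rev cols)))) //.
by case/lastP: (chain _ _) => // s x; rewrite last_rcons rev_rcons.
Qed.

Definition dominated (cols : seq (seq nat)) :=
  forall c, dom (nth [::] cols c) (nth [::] cols c.+1).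

(** A pick always exists: the entry picked in column [c.+1] is at least itself, so by dominance
    column [c] also has an entry that large. *)
Lemma filled_rowP cols : dominated cols -> all (fun C => C != [::]) cols ->
  size (filled_row cols) = size cols /\
  forall c, c < size cols ->
    [/\ nth 0 (filled_row cols) c \in nth [::] cols c,
        nth 0 (filled_row cols) c.+1 <= nth 0 (filled_row cols) c &
        forall z, z \in nth [::] cols c -> nth 0 (filled_row cols) c.+1 <= z ->
          nth 0 (filled_row cols) c <= z].
Proof.
elim: cols => [|C cols IH] hdom //= /andP[hC hne].
have [hs hn] := IH (fun c => hdom c.+1) hne; rewrite filled_row_cons /= hs; split=> //.
have hb : has (leq (head 0 (filled_row cols))) C.
  rewrite has_count; case: cols hdom hne {IH} hs hn => [|D cols] hdom hne hs hn.
    by rewrite -has_count; case: (C) hC.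
  apply: leq_trans (hdom 0 _); rewrite -has_count; apply/hasP.
  by have [h _ _] := hn 0 isT; rewrite -nth0; exists (nth 0 (filled_row (D :: cols)) 0).
case=> [|c] hc; last exact: hn.
by rewrite /= nth0; exact: mingeP.
Qed.

Lemma dominated_anti cols c d : dominated cols -> c <= d ->
  nth [::] cols c = [::] -> nth [::] cols d = [::].
Proof.
move=> h /subnK <- e; elim: (d - c) => [|n IH] //=.
by apply/size0nil/eqP; have := dom_size (h (n + c)); rewrite IH leqn0.
Qed.

Lemma last_nonempty (cols : seq (seq nat)) : ~~ all (fun C => C == [::]) cols ->
  let k := size cols - find (fun C => C != [::]) (rev cols) in
  [/\ 0 < k, k <= size cols, nth [::] cols k.-1 != [::] &
      forall c, k <= c -> nth [::] cols c = [::]].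
Proof.
move=> hn k.
have hh : has (fun C => C != [::]) (rev cols) by rewrite has_rev has_predC.
have hf : find (fun C => C != [::]) (rev cols) < size cols.
  by rewrite -(size_rev cols) -has_find.
have hk : 0 < k by rewrite /k subn_gt0.
split=> //; first exact: leq_subr.
  have := nth_find [::] hh; rewrite nth_rev //.
  by rewrite /k -subnS.
move=> c hc; case: (ltnP c (size cols)) => hcs; last by rewrite nth_default.
have hlt : size cols - c.+1 < find (fun C => C != [::]) (rev cols).
  by move: hc hf; rewrite /k; set f := find _ _; clearbody f; lia.
have := before_find [::] hlt; rewrite nth_rev; last by rewrite ltn_subrL /= (leq_ltn_trans _ hcs).
rewrite subnSK // subKn; last exact: ltnW.
by move/negbFE/eqP.
Qed.

(** Dominance, distinctness and positivity survive the extraction of a row, so induction applies to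
    the remaining columns; [L] lists the rows in order of extraction. *)
Lemma psi_loopP n cols out :
  dominated cols -> (forall c, uniq (nth [::] cols c)) ->
  (forall c, 0 \notin nth [::] cols c) -> size (nth [::] cols 0) <= n ->
  exists L, [/\ psi_loop n cols out = foldl setrow out L, all good_row L,
                pairwise after L & forall c, perm_eq (column L c) (nth [::] cols c)].
Proof.
elim: n cols out => [|n IH] cols out hdom hu h0 hsz.
  exists [::]; split=> // c; rewrite (@dominated_anti cols 0 c) //.
  by apply/size0nil/eqP; rewrite -leqn0.
rewrite /=; case: ifP => [hall|/negbT hn].
  exists [::]; split=> // c; case: (ltnP c (size cols)) => hc.
    by move/all_nthP: hall => /(_ [::] c hc) /eqP ->.
  by rewrite nth_default.
have [k0 ks hk1 hk] := last_nonempty hn; set k := _ - _ in k0 ks hk1 hk *.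
rewrite -/(filled_row (take k cols)); set ys := filled_row _.
have nth_tk c : c < k -> nth [::] (take k cols) c = nth [::] cols c by move=> hc; rewrite nth_take.
have sz_tk : size (take k cols) = k by rewrite size_takel.
have [hys hy] : size ys = k /\ forall c, c < k ->
    [/\ nth 0 ys c \in nth [::] cols c, nth 0 ys c.+1 <= nth 0 ys c &
     forall z, z \in nth [::] cols c -> nth 0 ys c.+1 <= z -> nth 0 ys c <= z].
  have [| |h1 h2] := @filled_rowP (take k cols).
  - move=> c; case: (ltnP c.+1 k) => hc; first by rewrite !nth_tk //; exact: ltnW.
    by rewrite (nth_default _ (n := c.+1)) ?sz_tk.
  - apply/(all_nthP [::]) => c; rewrite sz_tk => hc; rewrite nth_tk //.
    apply/eqP => e; move/eqP: hk1; apply; apply: dominated_anti e => //; lia.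
  rewrite sz_tk in h1 h2; split=> // c hc; rewrite -nth_tk //; exact: h2.
set cols' := _ ++ _.
have colsE c : nth [::] cols' c =
    if c < k then rem (nth 0 ys c) (nth [::] cols c) else [::].
  have szz : size (zip ys cols) = k by rewrite size_zip hys; apply/minn_idPl.
  rewrite /cols' nth_cat size_map szz; case: ltnP => hc.
    rewrite (nth_map (0, [::])) ?szz // nth_zip_cond szz hc //.
  by rewrite nth_drop hk //; lia.
have hys0 : head 0 ys = nth 0 ys 0 by rewrite nth0.
have mem' c z : z \in nth [::] cols' c -> [/\ c < k, z \in nth [::] cols c & z <> nth 0 ys c].
  by rewrite colsE; case: ifP => // hc; rewrite mem_rem_uniq // inE => /andP[/eqP].
have [|||| L [eL gL pL cL]] := IH cols' (setrow out ys).
(* Dominance is at risk only for [x] above the pick in column [c.+1] and at most the pick in column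
   [c]. By minimality of the latter, column [c] has no entry between the former and [x], so its
   count at [x] equals its count at the pick in column [c.+1]. That pick is counted there but not at
   [x], which gives a strict inequality. *)
- move=> c x; rewrite !colsE; case: (ltnP c.+1 k) => // hc; rewrite (ltnW hc).
  have [m1 d1 l1] := hy c (ltnW hc); have [m2 d2 l2] := hy _ hc.
  rewrite !count_rem m1 m2 /=.
  have hx := hdom c x; have hyc := hdom c (nth 0 ys c.+1).
  case: (leqP x (nth 0 ys c)) => hx1; last first.
    have -> : (x <= nth 0 ys c.+1) = false by lia.
    lia.
  case: (leqP x (nth 0 ys c.+1)) => hx2; first lia.
  have e : count (leq x) (nth [::] cols c) = count (leq (nth 0 ys c.+1)) (nth [::] cols c).
    apply: eq_in_count => z hz; apply/idP/idP => h; first lia.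
    exact: leq_trans (l1 z hz h).
  have lt : count (leq x) (nth [::] cols c.+1) <
            count (leq (nth 0 ys c.+1)) (nth [::] cols c.+1).
    rewrite (permP (perm_to_rem m2) (leq x)).
    rewrite (permP (perm_to_rem m2) (leq (nth 0 ys c.+1))) /= leqnn [x <= nth 0 ys c.+1]leqNgt hx2 /=.
    by rewrite add0n add1n ltnS; apply: sub_count => z /= hz; apply: leq_trans hz; exact: ltnW.
  lia.
- by move=> c; rewrite colsE; case: ifP => // _; exact: rem_uniq.
- by move=> c; apply/negP => /mem' [_ h _]; have := h0 c; rewrite h.
(* Every round removes one entry of the first column, so its size bounds the number of rounds. *)
- rewrite colsE k0 size_rem; last by have [] := hy 0 k0.
  by move: hsz; case: (size _).
exists (ys :: L); split=> //=.
- rewrite gL andbT; apply: good_rowP => [e|c|c]; rewrite ?hys.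
  + by move: k0; rewrite -hys e.
  + move=> hc; rewrite lt0n; apply/eqP => e; have [h _ _] := hy c hc.
    by have := h0 c; rewrite -e h.
  + by move=> hc; have [] := hy c (ltnW hc).
(* A remaining entry of column [c] differs from the pick there; by minimality it lies below the pick
   of column [c.+1] or above that of column [c]. *)
- rewrite pL andbT; apply/allP => S hS; apply/afterP.
  have hS' c : c < size S -> nth 0 S c \in nth [::] cols' c.
    by move=> hc; rewrite -(perm_mem (cL c)); exact: nth_mem_column.
  split; first by rewrite hys leqNgt; apply/negP => /hS' /mem' []; rewrite ltnn.
  move=> c /hS' /mem' [hc hz hne]; have [_ _ /(_ _ hz) h] := hy c hc; lia.
move=> c; rewrite column_cons hys; have := cL c; rewrite colsE; case: ltnP => hc h.
  have [m _ _] := hy c hc; rewrite perm_sym; apply: perm_trans (perm_to_rem m) _.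
  by rewrite perm_cons perm_sym.
by rewrite hk.
Qed.

Lemma size_column X c : size (column X c) = count (fun R => c < size R) X.
Proof. by rewrite /column size_map size_filter. Qed.

Lemma psi_qKT1 T : revSSYT T -> qKT1 (psi T) /\ forall c, column (psi T) c =i column T c.
Proof.
move=> hT; have hd := (cols_distinctP _).1 (revSSYT_distinct hT).
have [|c|c|| L [eL gL pL cL]] := @psi_loopP (sumn (map size T)) (columns T) [::].
- by move=> c; rewrite !nth_columns; apply: dom_column; apply: hT.2.2.2.1.
- by rewrite nth_columns.
- rewrite nth_columns; apply/negP => /columnP[r [hr e]].
  by have := hT.2.2.1 r c hr; rewrite e.
(* The fuel is the number of boxes, which is at least the size of the first column. *)
- rewrite nth_columns size_column; elim: (T) => //= R X IH; apply: leq_add IH.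
  by case: (size R).
have hpos : all (fun S => 0 < head 0 S) L by apply: sub_all gL => R; exact: good_row_head.
have aL : assembles (psi T) L.
  rewrite /psi eL; apply: assembles_foldl0 => //.
  (* The first entries of the rows form column 0 and are distinct, so no row overwrites another. *)
  have := hd 0; rewrite -nth_columns -(perm_uniq (cL 0)) /column.
  rewrite (_ : [seq R <- L | _] = L); last first.
    by apply/all_filterP; apply: sub_all gL => -[].
  by rewrite (eq_map (g := head 0)) // => R; rewrite nth0.
split; first exact: qKT1_assembles aL.
by move=> c x; rewrite (assembles_column c hpos aL) (perm_mem (cL c)) nth_columns.
Qed.

(** * Semi-skyline fillings and the column-filling *)

(* Given weakly decreasing rows, distinct column entries and first column equal to the row
   indices, this is equivalent to the triple conditions; unlike them it does not compare row
   lengths, so it makes sense for a partially built filling. *)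
Definition greedy (F : filling) := forall r s c, r < s ->
  in_cell F r c -> in_cell F s c.+1 -> entry F s c.+1 <= entry F r c ->
  entry F s c.+1 < entry F r c.+1.

Lemma in_cell_le X r c d : d <= c -> in_cell X r c -> in_cell X r d.
Proof. by move=> dc /in_cellE h; apply/in_cellE; apply: leq_ltn_trans h. Qed.

Lemma ASSF_greedy F : ASSF F -> greedy F.
Proof.
move=> [_ [_ [hdec [hd [[hA hB] h1]]]]].
(* a lower, shorter row starts below the higher one, and type B triples propagate this *)
have lt r s c : r < s -> size (row F r) < size (row F s) -> in_cell F r c -> in_cell F s c ->
    entry F r c < entry F s c.
  move=> rs sz; elim: c => [|c IH] hr hs; first by rewrite !h1.
  have hr' := in_cell_le (leqnSn c) hr; have hs' := in_cell_le (leqnSn c) hs.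
  have := IH hr' hs'; have := hdec _ _ hr; have := hB r s c rs sz hs' hs hr'.
  rewrite /inversion_triple; lia.
move=> r s c rs hr hs le; have hs' := in_cell_le (leqnSn c) hs.
(* If the lower row is shorter, a type B triple contradicts [le]; otherwise a type A triple gives
   the claim. *)
case: (ltnP (size (row F r)) (size (row F s))) => sz.
  have := lt r s c rs sz hr hs'; have := hB r s c rs sz hs' hs hr; rewrite /inversion_triple; lia.
have hr' : in_cell F r c.+1 by apply/in_cellE; apply: leq_trans sz; exact/in_cellE.
have ne : entry F r c.+1 <> entry F s c.+1 by apply: hd => // e; rewrite e ltnn in rs.
have := hA r s c rs sz hr hr' hs; rewrite /inversion_triple; lia.
Qed.

Lemma greedy_ASSF F : skyline_wf F -> all_pos F -> rows_weakly_decr F -> cols_distinct F ->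
  (forall r, in_cell F r 0 -> entry F r 0 = r.+1) -> greedy F -> ASSF F.
Proof.
move=> wf hpos hdec hd h1 hG; do !split=> //.
  move=> r s c rs sz hr hr' hs; rewrite /inversion_triple.
  have := hG r s c rs hr hs; have := hdec _ _ hr'; lia.
(* a lower row with a larger entry stays ahead, hence is at least as long *)
have ahead r s c : r < s -> size (row F r) < size (row F s) -> in_cell F r c -> in_cell F s c ->
    ~ entry F s c < entry F r c.
  move=> rs sz hr hs lt.
  have key d : c <= d -> in_cell F s d -> in_cell F r d /\ entry F s d < entry F r d.
    move=> /subnK <-; elim: (d - c) => [|n IH] // hsn.
    have [hrn ltn] := IH (in_cell_le (leqnSn _) hsn).
    have h : entry F s (n + c).+1 < entry F r (n + c).+1.
      by apply: hG => //; apply: leq_trans (hdec _ _ hsn) (ltnW ltn).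
    by split=> //; apply: entry_gt0; apply: leq_trans h.
  have [|//|/in_cellE] := key (size (row F r)); last by rewrite ltnn.
    by move/in_cellE/ltnW: hr.
  exact/in_cellE.
move=> r s c rs sz hs hs' hr; rewrite /inversion_triple.
(* Only the second form of an inversion triple occurs here; its failure would, by [greedy], put the
   shorter row ahead in column [c.+1]. *)
have := hdec _ _ hs'; case: (ltnP (entry F r c) (entry F s c.+1)) => [|le _]; first by right.
have lt := hG _ _ _ rs hr hs' le; exfalso; apply: (ahead r s c.+1) => //.
by apply: entry_gt0; apply: leq_trans lt.
Qed.

(** Entries of column [c.+1] are located from the largest down: column [c] and the positions of all
    larger entries determine the row of [x]. *)
Lemma greedy_column_inj F G c :
  greedy F -> greedy G -> cols_distinct F -> cols_distinct G ->
  (forall r, in_cell F r c -> in_cell G r c /\ entry G r c = entry F r c) ->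
  (forall r, in_cell G r c -> in_cell F r c /\ entry F r c = entry G r c) ->
  rows_weakly_decr F -> rows_weakly_decr G ->
  column F c.+1 =i column G c.+1 ->
  forall r, in_cell F r c.+1 -> in_cell G r c.+1 /\ entry G r c.+1 = entry F r c.+1.
Proof.
move=> gF gG dF dG FG GF wF wG e.
pose same X Y x := forall r, in_cell X r c.+1 -> entry X r c.+1 = x ->
  in_cell Y r c.+1 /\ entry Y r c.+1 = x.
have up x : (forall y, x < y -> same F G y) /\ (forall y, x < y -> same G F y) ->
    same F G x /\ same G F x.
  (* if [x] sat lower in [X] than in [Y], the row holding it in [X]
     would hold a larger entry in [Y] *)
  have half X Y s t : greedy Y -> (forall y, x < y -> same Y X y) -> rows_weakly_decr X ->
      (forall r, in_cell X r c -> in_cell Y r c /\ entry Y r c = entry X r c) ->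
      in_cell X s c.+1 -> entry X s c.+1 = x -> in_cell Y t c.+1 -> entry Y t c.+1 = x ->
      ~ s < t.
    move=> gY hYX wX XY hs es ht et st; have [hsY esY] := XY s (in_cell_le (leqnSn c) hs).
    have lt : x < entry Y s c.+1.
      by have := wX _ _ hs; rewrite -et => h; apply: gY; rewrite // esY et -es.
    have [|_] := hYX _ lt s _ erefl; first by apply: entry_gt0; apply: leq_trans lt.
    by rewrite es => h; rewrite -h ltnn in lt.
  move=> [hFG hGF]; split=> s hs es.
    have /columnP[t [ht et]] : x \in column G c.+1 by rewrite -e; apply/columnP; exists s.
    case: (ltngtP s t) => [h|h|-> //]; exfalso.
      exact: (half F G s t).
    exact: (half G F t s).
  have /columnP[t [ht et]] : x \in column F c.+1 by rewrite e; apply/columnP; exists s.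
  case: (ltngtP s t) => [h|h|-> //]; exfalso.
    exact: (half G F s t).
  exact: (half F G t s).
(* Downward induction on [x]: above the sum of both columns no entry exists and the claim is
   vacuous. *)
have all_same n x : sumn (column F c.+1) + sumn (column G c.+1) < x + n ->
    same F G x /\ same G F x.
  elim: n x => [|n IH] x hx.
    have big X r : in_cell X r c.+1 -> entry X r c.+1 <= sumn (column X c.+1).
      move=> hr; have /perm_to_rem/perm_sumn -> : entry X r c.+1 \in column X c.+1.
        by apply/columnP; exists r.
      by rewrite /= leq_addr.
    by split=> r /big h ex; exfalso; move: h hx; rewrite ex; lia.
  by apply: up; split=> y xy; have [|h1 h2] := IH y; try lia.
move=> r hr; have [h _] := @all_same (sumn (column F c.+1) + sumn (column G c.+1)).+1
  (entry F r c.+1) (leq_addl _ _).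
exact: h.
Qed.

Lemma ASSF_inj F G : ASSF F -> ASSF G -> (forall c, column F c =i column G c) -> F = G.
Proof.
move=> hF hG e; have gF := ASSF_greedy hF; have gG := ASSF_greedy hG.
case: hF => wfF [_ [wF [dF [_ h1F]]]]; case: hG => wfG [_ [wG [dG [_ h1G]]]].
have h c : (forall r, in_cell F r c -> in_cell G r c /\ entry G r c = entry F r c) /\
           (forall r, in_cell G r c -> in_cell F r c /\ entry F r c = entry G r c).
  elim: c => [|c [FG GF]].
    have zero X Y r : (forall r, in_cell X r 0 -> entry X r 0 = r.+1) ->
        (forall r, in_cell Y r 0 -> entry Y r 0 = r.+1) ->
        column X 0 =i column Y 0 -> in_cell X r 0 -> in_cell Y r 0 /\ entry Y r 0 = entry X r 0.
      move=> hX hY {}e hr; have /columnP[s [hs]] : r.+1 \in column Y 0.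
        by rewrite -e -(hX r hr); apply/columnP; exists r.
      by rewrite (hY s hs) => -[es]; subst s; rewrite hX // hY.
    by split=> r; apply: zero => // x; rewrite e.
  split; first exact: greedy_column_inj (e _).
  by apply: greedy_column_inj => // x; rewrite e.
apply: filling_ext => // r; apply: seq_ext => c.
  by apply/idP/idP => /in_cellE; [move/(h c).1 => [/in_cellE] | move/(h c).2 => [/in_cellE]].
case: (ltnP c (size (row F r))) => [/in_cellE/(h c).1 [] //|hF].
case: (ltnP c (size (row G r))) => [/in_cellE/(h c).2 [] //|hG].
by rewrite !nth_default.
Qed.

(** * Correctness of the column-filling *)

Definition partial_ASSF (m : nat) (F : filling) :=
  [/\ skyline_wf F, all_pos F, rows_weakly_decr F, greedy F &
      (forall r, in_cell F r 0 -> entry F r 0 = r.+1) /\ forall r, size (row F r) <= m].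

(** The last hypothesis provides a row for [x]; choosing the lowest such row, after all larger
    entries of the column, preserves [greedy]. *)
Lemma placeP i F x : partial_ASSF i.+2 F -> 0 < x ->
  (forall y, y \in column F i.+1 -> x < y) ->
  size (column F i.+1) < count (leq x) (column F i) ->
  [/\ partial_ASSF i.+2 (place i.+1 F x),
      perm_eq (column (place i.+1 F x) i.+1) (x :: column F i.+1) &
      forall c, c != i.+1 -> column (place i.+1 F x) c = column F c].
Proof.
move=> [wf hpos hdec hG [h1 hsz]] x0 hx hcap.
rewrite /place /=; set ok := fun r : seq nat => _; set r := find ok F.
(* Pigeonhole: otherwise every row whose entry in column [i] is at least [x] would already have a
   box in column [i.+1]. *)
have hok : has ok F.
  apply: contraLR hcap => hn; rewrite -leqNgt size_column count_column.
  apply: (@leq_trans (count (predU (fun R => i.+1 < size R) ok) F)).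
    apply: sub_count => R /= /andP[h1' h2']; rewrite /ok h2' andbT; lia.
  rewrite -(leq_add2r (count (predI (fun R => i.+1 < size R) ok) F)) count_predUI leq_add2l.
  by move: hn; rewrite has_count -leqNgt leqn0 => /eqP ->.
have hr : r < size F by rewrite -has_find.
rewrite hr; have /andP[/eqP szr xr] : ok (row F r) by exact: nth_find.
have hmin s : s < r -> ~~ ok (row F s) by move=> h; rewrite /row before_find.
rewrite -/(row F r) /= in xr szr *; set F' := set_nth _ _ _ _.
have rowE s : row F' s = if s == r then rcons (row F r) x else row F s.
  by rewrite /row nth_set_nth.
have cellE s c : in_cell F' s c <-> in_cell F s c \/ s = r /\ c = i.+1.
  rewrite !in_cellE rowE; case: eqP => [->|ne]; rewrite ?size_rcons ?szr; last by intuition.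
  by rewrite ltnS leq_eqVlt; split=> [/orP[/eqP|]|[|[_ ->]]]; rewrite ?eqxx; auto; move=> ->; rewrite orbT.
have entE s c : in_cell F s c -> entry F' s c = entry F s c.
  by move=> /in_cellE hc; rewrite /entry rowE; case: eqP hc => // -> hc; rewrite nth_rcons hc.
have colF c : column F c = column (take r F) c ++ column (row F r :: drop r.+1 F) c.
  by rewrite -column_cat /row -drop_nth // cat_take_drop.
have colF' c : column F' c = column (take r F) c ++ column (rcons (row F r) x :: drop r.+1 F) c.
  by rewrite /F' set_nthE hr column_cat.
have entx : entry F' r i.+1 = x by rewrite /entry rowE eqxx nth_rcons szr ltnn eqxx.
have cri : in_cell F r i by apply/in_cellE; rewrite szr.
have ncell s : ~ in_cell F s i.+2 by move/in_cellE; have := hsz s; lia.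
have cx s : in_cell F s i.+1 -> x < entry F s i.+1 by move=> h; apply: hx; apply/columnP; exists s.
split.
- split.
  + right; rewrite -nth_last -[X in X <> _]/(row F' _) rowE; case: eqP => _.
      by case: (row F r).
    rewrite /F' size_set_nth (_ : maxn _ _ = size F); last by apply/maxn_idPr.
    case: wf => [e|]; first by rewrite e in hr.
    by rewrite -nth_last.
  + by move=> s c /cellE[h|[-> ->]]; rewrite ?entx // entE //; exact: hpos.
  + move=> s c /cellE[h|[-> [->]]]; last by rewrite entx entE.
    by rewrite !entE //; [exact: hdec | exact: in_cell_le h].
  + move=> s t c st /cellE[hs|[-> ->]] /cellE[ht|[et ec]].
    * rewrite !(entE _ _ ht) (entE _ _ hs) => /(hG _ _ _ st hs ht) h.
      by rewrite entE //; apply: entry_gt0; apply: leq_trans h.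
    (* The lower row [s] was passed over although its entry in column [i] is large enough, so its
       box in column [i.+1] is already filled, by a value above [x]. *)
    * case: ec => ec; subst t c; rewrite entx (entE _ _ hs) => le.
      have hs' : in_cell F s i.+1.
        have := hmin s st; rewrite /ok /= -/(entry F s i) le andbT => ne.
        apply/in_cellE; move/in_cellE in hs; lia.
      by rewrite entE //; exact: cx.
    * by case: (ncell t).
    * by move: ec; lia.
  split=> [s /cellE[h|[_ //]]|s]; first by rewrite entE // h1.
  by rewrite rowE; case: eqP => // _; rewrite size_rcons szr.
- rewrite colF colF' !column_cons size_rcons szr leqnn ltnn nth_rcons szr ltnn eqxx.
  by rewrite -cat1s perm_catCA.
move=> c ne; rewrite colF colF' !column_cons size_rcons szr nth_rcons szr.
by rewrite (_ : (c < i.+2) = (c < i.+1)); [case: ltnP | lia].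
Qed.

(** Dominance is required of placed and pending entries together; moving an entry from one group to
    the other only permutes that list. *)
Lemma foldl_placeP i xs F : partial_ASSF i.+2 F -> sorted gtn xs -> 0 \notin xs ->
  (forall x y, x \in xs -> y \in column F i.+1 -> x < y) ->
  dom (column F i) (column F i.+1 ++ xs) ->
  [/\ partial_ASSF i.+2 (foldl (place i.+1) F xs),
      perm_eq (column (foldl (place i.+1) F xs) i.+1) (column F i.+1 ++ xs) &
      forall c, c != i.+1 -> column (foldl (place i.+1) F xs) c = column F c].
Proof.
elim: xs F => [|x xs IH] F hF hs h0 hlt hdom /=; first by split=> //; rewrite cats0.
have hlt' y : y \in column F i.+1 -> x < y by apply: hlt; exact: mem_head.
have [||| hF' pF' eF'] := @placeP i F x hF.
- by move: h0; rewrite inE lt0n eq_sym negb_or => /andP[].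
- exact: hlt'.
(* All placed entries exceed [x], so the count at [x] includes each of them and [x] itself; hence
   the strict inequality. *)
- apply: leq_trans (hdom x); rewrite count_cat /= leqnn.
  have -> : count (leq x) (column F i.+1) = size (column F i.+1).
    by apply/eqP; rewrite -all_count; apply/allP => y /hlt' /ltnW.
  lia.
have gtxs : all (gtn x) xs by apply: order_path_min hs => a b d /= h1 h2; apply: ltn_trans h2 h1.
have pcat : perm_eq (column (place i.+1 F x) i.+1 ++ xs) (column F i.+1 ++ x :: xs).
  apply: (@perm_trans _ ((x :: column F i.+1) ++ xs)); first by rewrite perm_cat2r.
  by rewrite -cat1s -catA perm_catCA.
have [|||| h1 h2 h3] := IH _ hF'.
- exact: path_sorted hs.
- by move: h0; rewrite inE negb_or => /andP[].
- move=> z y hz; rewrite (perm_mem pF') inE => /orP[/eqP ->|hy].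
    by move/allP: gtxs => /(_ z hz).
  by apply: hlt => //; rewrite inE hz orbT.
- by move=> z; rewrite (permP pcat) eF'; [exact: hdom | lia].
split=> // [|c hc]; first exact: perm_trans pcat.
by rewrite h3 // eF'.
Qed.

Lemma partial_ASSFW m n F : m <= n -> partial_ASSF m F -> partial_ASSF n F.
Proof.
by move=> mn [? ? ? ? [? h]]; split=> //; split=> // r; apply: leq_trans mn.
Qed.

Lemma foldl_place_columnP V n m F : rows_weakly_decr V -> all_pos V -> cols_distinct V ->
  partial_ASSF m.+1 F -> (forall c, c < m.+1 -> perm_eq (column F c) (column V c)) ->
  let G := foldl (place_column V) F (iota m.+1 n) in
  partial_ASSF (m + n).+1 G /\ forall c, c < (m + n).+1 -> perm_eq (column G c) (column V c).
Proof.
move=> wV pV /cols_distinctP dV; elim: n m F => [|n IH] m F hF cF /=; first by rewrite addn0.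
have hm : column F m.+1 = [::] by case: hF => _ _ _ _ [_ h]; exact: column_size_le h _.
have [|||||h1 h2 h3] := @foldl_placeP m (sort geq (column V m.+1)) F.
- exact: partial_ASSFW hF.
- exact: uniq_sorted_gtn.
- rewrite mem_sort; apply/negP => /columnP[r [hr e]].
  by have := pV _ _ hr; rewrite e.
- by move=> x y _; rewrite hm.
- move=> x; rewrite hm /= (permP (permEl (perm_sort _ _))) (permP (cF m _)) //.
  exact: dom_column.
rewrite addnS -addSn; apply: IH => // c hc.
case: (c =P m.+1) => [->|/eqP ne]; last by rewrite h3 // cF //; lia.
by apply: perm_trans h2 _; rewrite hm /= perm_sort.
Qed.

Lemma Gamma_ASSF T : revSSYT T -> ASSF (Gamma T) /\ forall c, column (Gamma T) c =i column T c.
Proof.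
move=> hT; have dT := revSSYT_distinct hT; have pT := hT.2.2.1; have wT := hT.2.2.2.1.
pose L := [seq [:: i] | i <- column T 0].
have posL : all (fun S => 0 < head 0 S) L.
  by rewrite all_map; apply/allP => x /columnP[r [hr <-]]; exact: pT.
have L0 : map (head 0) L = column T 0 by rewrite -map_comp map_id.
have first_column s X : foldl (fun out i => set_nth [::] out i.-1 [:: i]) X s =
    foldl setrow X [seq [:: i] | i <- s].
  by elim: s X => //= x s IH X; rewrite IH.
rewrite /Gamma first_column -/L.
set F := foldl setrow _ _.
have aF : assembles F L.
  by apply: assembles_foldl0; rewrite // L0; exact: (cols_distinctP _).1.
have rowF r c : in_cell F r c -> c = 0 /\ entry F r 0 = r.+1.
  move=> /in_cellE hc; case: aF => _ /(_ r) h _.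
  have [|/mapP[x _ e] ->] := h; first by move=> e; rewrite e in hc.
  by move: hc; rewrite e ltnS leqn0 => /eqP.
have hF : partial_ASSF 1 F.
  split; first by case: aF.
  - by move=> r c h; have [e] := rowF _ _ h; rewrite e => ->.
  - by move=> r c /rowF[].
  - by move=> r s c _ _ /rowF[].
  split=> [r /rowF[]//|r]; rewrite leqNgt; apply/negP => h.
  by have [] := rowF r 1 ((in_cellE _ _ _).2 h).
have cF c : c < 1 -> perm_eq (column F c) (column T c).
  rewrite ltnS leqn0 => /eqP ->; apply: uniq_perm.
  - apply: (cols_distinctP _).1 => r s d hr hs rs.
    have [e1 e2] := rowF _ _ hr; have [_ e3] := rowF _ _ hs.
    by rewrite e1 e2 e3 => -[].
  - exact: (cols_distinctP _).1.
  move=> x; rewrite (assembles_column 0 posL aF) /column /L filter_map -map_comp.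
  by rewrite (eq_filter (a2 := predT)) // filter_predT map_id.
have [] := @foldl_place_columnP T (ncols T).-1 0 F wT pT dT hF cF.
rewrite add0n; set G := foldl _ _ _ => hG cG.
have colG c : perm_eq (column G c) (column T c).
  (* The bound [(ncols T).-1.+1] is [ncols T], or 1 for the empty tableau; from there on both
     columns are empty. *)
  case: (ltnP c (ncols T).-1.+1) => hc; first exact: cG.
  rewrite (@column_ncols T c); last lia.
  by case: hG => _ _ _ _ [_ h]; rewrite (column_size_le h).
split=> [|c]; last exact: perm_mem.
case: hG => ? ? ? ? [? _]; apply: greedy_ASSF => //.
by apply/cols_distinctP => c; rewrite (perm_uniq (colG c)); exact: (cols_distinctP _).1.
Qed.

Theorem theorem5p10 :
  bij_between HrevSSYT HqKT1 psi /\ bij_between HrevSSYT HSSF Gamma.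
Proof.
split; apply: bij_of_columns.
- exact: psi_qKT1.
- by move=> Q [_ [? [? [_ [? _]]]]].
- exact: qKT1_inj.
- exact: Gamma_ASSF.
- by move=> Q [_ [? [? [? _]]]].
exact: ASSF_inj.
Qed.
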